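(* Let $p$ be an odd prime and let $(s_u)_{u\ge 0}$ be the $2p$-periodic quaternary sequence over $\mathbb{Z}_4$ defined by $$ s_u=\begin{cases} 0, & \text{if } u \bmod 2p=0 \text{ or } u \bmod 2p\in D_0,\\ 1, & \text{if } u \bmod 2p\in D_1,\\ 2, & \text{if } u \bmod 2p=p \text{ or } u \bmod 2p\in E_0,\\ 3, & \text{if } u \bmod 2p\in E_1. \end{cases} $$ Then the linear complexity of $(s_u)_{u\ge 0}$ over $\mathbb{Z}_4$ satisfies $$ LC((s_u)_{u\ge 0})=\begin{cases} 2p, & \text{if } p\equiv -3 \pmod 8,\\ 2p-1, & \text{if } p\equiv 3 \pmod 8. \end{cases} $$
   Context: Let $p$ be an odd prime and let $g$ be an odd integer that is a primitive root both modulo $p$ and modulo $2p$. Write $\mathbb{Z}_{2p}=\{0,1,\ldots,2p-1\}$ for the residue class ring modulo $2p$ and put $$D_0=\{g^{2n} \bmod 2p : 0\le n\le (p-3)/2\},\qquad D_1=\{g^{2n+1} \bmod 2p : 0\le n\le (p-3)/2\},$$ and $E_i=\{2u \bmod 2p : u\in D_i\}$ for $i=0,1$. Then $\mathbb{Z}_{2p}$ is the disjoint union $D_0\cup D_1\cup E_0\cup E_1\cup\{0,p\}$. $\mathbb{Z}_4=\{0,1,2,3\}$ is the residue class ring modulo $4$. The linear complexity $LC((s_u)_{u\ge0})$ of a sequence over $\mathbb{Z}_4$ is the least $L$ for which there exist $c_1,\ldots,c_L\in\mathbb{Z}_4$ with $s_{u+L}+c_1s_{u+L-1}+\cdots+c_{L-1}s_{u+1}+c_Ls_u=0$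 for all $u\ge 0$. *)

(* Defs.v *)
From mathcomp Require Import all_boot all_order all_algebra.

Set Implicit Arguments.
Unset Strict Implicit.
Unset Printing Implicit Defensive.

Import GRing.Theory.
Local Open Scope ring_scope.

(* The ring 'Z_m is the ring of residues modulo m only for m > 1; below it is
   used for m = 4 and, with p an odd prime, for m = p and m = 2 * p. *)

(* g generates the multiplicative group modulo m, i.e., its class has
   multiplicative order totient m. *)
Definition primitive_root_mod (m : nat) (g : int) : bool :=
  (totient m).-primitive_root (g%:~R : 'Z_m).

(* D_i (i = 0, 1): the exponent index n ranges over 0 <= n <= (p - 3) / 2. *)
Definition Dset (p : nat) (g : int) (i : nat) : {set 'Z_(2 * p)} :=
  [set (g%:~R : 'Z_(2 * p)) ^+ (2 * n + i)%N | n : 'I_((p - 3) %/ 2).+1].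

Definition Eset (p : nat) (g : int) (i : nat) : {set 'Z_(2 * p)} :=
  [set 2%:R * u | u in Dset p g i].

(* The five conditions cover 'Z_(2 * p) under the hypotheses on p and g, so the
   last default value is never reached. *)
Definition quaternary_seq (p : nat) (g : int) (u : nat) : 'Z_4 :=
  let x : 'Z_(2 * p) := u%:R in
  if (x == 0) || (x \in Dset p g 0) then 0
  else if x \in Dset p g 1 then 1
  else if (x == p%:R) || (x \in Eset p g 0) then 2%:R
  else if x \in Eset p g 1 then 3%:R
  else 0.

(* Only the coefficients c 1, ..., c L matter. *)
Definition has_recurrence (s : nat -> 'Z_4) (L : nat) : Prop :=
  exists c : nat -> 'Z_4, forall u : nat,
    s (u + L)%N + \sum_(1 <= i < L.+1) c i * s (u + L - i)%N = 0.

Definition linear_complexity (s : nat -> 'Z_4) (L : nat) : Prop :=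
  has_recurrence s L /\ forall M : nat, has_recurrence s M -> (L <= M)%N.

(* Main.v *)
Require Import Defs.
From HB Require Import structures.
From mathcomp Require Import all_boot all_order all_algebra.
From mathcomp Require Import zify ring.

(* Write S for the generating polynomial of one period, C for the connection
   polynomial, so that (X^(2p) - 1) divides S C over Z_4, and put h = (p - 1)/2.
   Since 2 is a non-residue modulo p, s_k + s_(k+p) = 3 for 0 < k < p, which gives
   S = -1 modulo Phi = 1 + X + ... + X^(p-1).  Modulo 2 we have
   X^(2p) - 1 = (X - 1)^2 Phi^2, hence Phi^2 divides C modulo 2.  Moreover
   S = 5h + (h + 2) X modulo X^2 - 1.  If p = 5 mod 8 this is the constant 2, so
   2C = 0 modulo X^2 - 1 and (X - 1)^2 divides C modulo 2; if p = 3 mod 8 it is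
   1 - X, so X - 1 divides C modulo 2, and S(1) = 0 gives the recurrence of
   length 2p - 1 with all coefficients 1. *)

Set Implicit Arguments.
Unset Strict Implicit.
Unset Printing Implicit Defensive.

(** * Quadratic residues modulo p and the classes D_i and E_i *)

Section PrimeField.

Import GRing.Theory.
Local Open Scope ring_scope.

(* In Z/(2h+1), (-1)^i i is the even number i or 2(h - (i-1)/2) according to the
   parity of i; multiply over 1 <= i <= n, with 'C(n+1, 2) = 1 + ... + n.  For
   n = h this yields 2^h = (-1)^(h(h+1)/2). *)
Lemma ring_gauss_fact (R : comNzRingType) (h n : nat) :
  (2 * h).+1%:R = 0 :> R -> (n <= h)%N ->
  (-1) ^+ 'C(n.+1, 2) * n`!%:R =
    2%:R ^+ n * (n./2)`!%:R * (h ^_ (uphalf n))%:R :> R.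
Proof.
move=> h0; elim: n => [|n IHn] le_nh; first by rewrite !mulr1.
have {}IHn := IHn (ltnW le_nh).
have -> : (-1) ^+ 'C(n.+2, 2) * (n.+1)`!%:R =
          (-1) ^+ n.+1 * n.+1%:R * ((-1) ^+ 'C(n.+1, 2) * n`!%:R) :> R.
  by rewrite factS natrM binS bin1 exprD; ring.
rewrite IHn -signr_odd exprS uphalfE /=.
have [n_odd|n_even] := boolP (odd n).
  have -> : n.+1%:R = 2%:R * (n./2).+1%:R :> R by rewrite -natrM; congr _%:R; lia.
  have -> : uphalf n = (n./2).+1 by lia.
  by rewrite factS !natrM expr0; ring.
have nE : n = n./2.*2 by lia.
have -> : uphalf n = n./2 by lia.
rewrite ffactnSr natrM.
have -> : n.+1%:R = - (2 * (h - n./2))%:R :> R.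
  by apply/eqP; rewrite -addr_eq0 -natrD -h0; apply/eqP; congr _%:R; lia.
by rewrite natrM expr1; ring.
Qed.

Variable p : nat.
Hypotheses (p_prime : prime p) (p_odd : odd p).
Let h := p.-1./2.

Lemma Fp_nat_eq0 n : (n%:R == 0 :> 'F_p) = (p %| n)%N.
Proof. by rewrite (dvdn_pcharf (pchar_Fp p_prime)). Qed.

Lemma Fp_nat_eq m n : (m%:R == n%:R :> 'F_p) = (m == n %[mod p])%N.
Proof. by rewrite -val_eqE /= !val_Fp_nat. Qed.

Lemma Fp_two_neq0 : 2%:R != 0 :> 'F_p.
Proof.
rewrite Fp_nat_eq0; apply: contraL p_odd => /(dvdn_leq (isT : 0 < 2)%N).
by have := prime_gt1 p_prime; lia.
Qed.

Lemma Fp_fact_neq0 n : (n < p)%N -> n`!%:R != 0 :> 'F_p.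
Proof.
rewrite Fp_nat_eq0; elim: n => [|n IHn] n_lt; first by rewrite dvdn1 gtn_eqF ?prime_gt1.
by rewrite factS Euclid_dvdM // negb_or gtnNdvd //= IHn // ltnW.
Qed.

(** Take [n = h] in [ring_gauss_fact] and cancel h!. For p = 3 or 5 modulo 8, h is 1 or 2 modulo 4,
    so h(h + 1)/2 is odd. *)
Lemma two_expf_half :
  (p %% 8 = 3 \/ p %% 8 = 5)%N -> 2%:R ^+ h = -1 :> 'F_p.
Proof.
move=> p8; have hE : (2 * h).+1 = p by rewrite /h; lia.
have h0 : (2 * h).+1%:R = 0 :> 'F_p by rewrite hE pchar_Fp_0.
have := ring_gauss_fact h0 (leqnn h).
have -> : 'C(h.+1, 2) = (h * h.+1)./2 by rewrite bin2 mulnC.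
rewrite -signr_odd.
have -> : odd (h * h.+1)./2.
  have [k hE'] : exists k, (h = 4 * k + 1 \/ h = 4 * k + 2)%N by exists (h %/ 4)%N; lia.
  case: hE' => ->.
    have -> : ((4 * k + 1) * (4 * k + 1).+1 = (8 * (k * k) + 6 * k + 1).*2)%N by lia.
    by rewrite doubleK; lia.
  have -> : ((4 * k + 2) * (4 * k + 2).+1 = (8 * (k * k) + 10 * k + 3).*2)%N by lia.
  by rewrite doubleK; lia.
(* The two factorial factors multiply to h!, which is nonzero modulo p. *)
have -> : (h./2 = h - uphalf h)%N by lia.
rewrite -mulrA -natrM [X in _ = _ * X%:R]mulnC ffact_fact; last by lia.
by move/(mulIf (Fp_fact_neq0 _))=> <- //; rewrite /h; lia.
Qed.

Lemma expf_pred (x : 'F_p) : x != 0 -> x ^+ p.-1 = 1.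
Proof.
move=> x0; apply: (mulfI x0); rewrite mulr1 -exprS prednK ?prime_gt0 //.
rewrite -[x]natr_Zp -natrX; apply/eqP; rewrite Fp_nat_eq; apply/eqP.
exact: fermat_little.
Qed.

Lemma expf_half_pm1 (x : 'F_p) : x != 0 -> (x ^+ h == 1) || (x ^+ h == -1).
Proof.
move=> x0; rewrite -sqrf_eq1 -exprM.
have -> : (h * 2 = p.-1)%N by rewrite /h; lia.
by rewrite expf_pred.
Qed.

Lemma Fp_one_neqN1 : (1 == -1 :> 'F_p) = false.
Proof. by rewrite -addr_eq0; apply: negbTE Fp_two_neq0. Qed.

Lemma Z2p_nat_eq m n :
  (m%:R == n%:R :> 'Z_(2 * p)) =
  (odd m == odd n) && (m%:R == n%:R :> 'F_p).
Proof.
have p_gt1 := prime_gt1 p_prime.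
rewrite -val_eqE /= !val_Zp_nat; try lia.
rewrite chinese_remainder ?Fp_nat_eq ?coprime2n // !modn2.
by case: (odd m); case: (odd n).
Qed.

Variable g : int.
Hypothesis g_root : primitive_root_mod p g.

Lemma root_prim : p.-1.-primitive_root (g%:~R : 'F_p).
Proof.
(* ['F_p] unfolds to ['Z_(pdiv p)], whereas the hypothesis speaks of ['Z_p]. *)
have : primitive_root_mod (pdiv p) g by rewrite pdiv_id.
have -> // : p.-1 = totient (pdiv p) by rewrite pdiv_id // totient_prime.
Qed.

Lemma root_neq0 : (g%:~R : 'F_p) != 0.
Proof.
apply/eqP=> g0; have := prim_expr_order root_prim; rewrite g0 expr0n.
by have := prime_gt1 p_prime; case: p => [|[|q]] //= _ /esym/eqP; rewrite oner_eq0.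
Qed.

Lemma root_half : (g%:~R : 'F_p) ^+ h = -1.
Proof.
have p_gt1 := prime_gt1 p_prime.
case/orP: (expf_half_pm1 root_neq0) => /eqP // g1.
by have := prim_order_dvd root_prim h; rewrite g1 eqxx gtnNdvd // /h; lia.
Qed.

Hypothesis g_odd : odd `|g|%N.

(** Taking the residue of g in [0, 2p) turns powers of g into casts of naturals, to which
    [Z2p_nat_eq] applies; it stays odd since 2p is even. *)
Lemma odd_root_lift : exists N : nat,
  [/\ odd N, g%:~R = N%:R :> 'Z_(2 * p) & g%:~R = N%:R :> 'F_p].
Proof.
have p_gt1 := prime_gt1 p_prime.
have N0 : ((2 * p)%:Z != 0)%R by lia.
have gE := divz_eq g (2 * p)%:Z.
have g_ge0 := modz_ge0 g N0.
have cast (R : nzRingType) : (2 * p)%:R = 0 :> R ->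
    g%:~R = `|(g %% (2 * p)%:Z)%Z|%N%:R :> R.
  move=> p0; rewrite {1}gE -{1}(gez0_abs g_ge0) intrD intrM.
  by rewrite -!pmulrn p0 mulr0 add0r.
exists `|(g %% (2 * p)%:Z)%Z|%N; split.
- by move: g_odd g_ge0 gE; set m := (g %% _)%Z; set q := (g %/ _)%Z; nia.
- by apply: cast; rewrite pchar_Zp //; lia.
by apply: cast; rewrite natrM pchar_Fp_0 // mulr0.
Qed.

(** Since g^h = -1, the parity of the exponent of g can be read off from the h-th power modulo p
    (Euler's criterion). *)
Lemma mem_Dset u i : (i < 2)%N ->
  (u%:R \in Dset p g i) =
  [&& odd u, u%:R != 0 :> 'F_p & (u%:R : 'F_p) ^+ h == (-1) ^+ i].
Proof.
move=> i2; have [N [N_odd gN gFN]] := odd_root_lift.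
have p_gt1 := prime_gt1 p_prime.
have g0 := root_neq0.
have hp : (((p - 3) %/ 2).+1 = h)%N by rewrite /h; lia.
apply/imsetP/and3P => [[n _ /eqP]|[u_odd u0 /eqP uh]].
  rewrite gN -natrX Z2p_nat_eq oddX N_odd orbT natrX -gFN => /andP[/eqP -> /eqP ->].
  split=> //; first by rewrite expf_neq0.
  by rewrite exprAC root_half exprD exprM sqrrN !expr1n mul1r.
have [j uE] := prim_rootP root_prim (expf_pred u0).
have j_lt := ltn_ord j.
have n_lt : (j./2 < ((p - 3) %/ 2).+1)%N by rewrite hp /h; lia.
exists (Ordinal n_lt) => //=; apply/eqP.
(* Comparing (-1)^j = u^h = (-1)^i shows that i is the parity of j. *)
have -> : (2 * j./2 + i = j)%N.
  move: uh; rewrite uE exprAC root_half => /eqP.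
  rewrite -(signr_odd _ j).
  case: i i2 => [|[|i]] //= _; case: (boolP (odd j)) => j_odd.
  - by rewrite expr1 eq_sym Fp_one_neqN1.
  - by lia.
  - by lia.
  - by rewrite expr1 Fp_one_neqN1.
by rewrite gN -natrX Z2p_nat_eq oddX N_odd orbT u_odd natrX -gFN uE !eqxx.
Qed.

Hypothesis p_mod8 : (p %% 8 = 3 \/ p %% 8 = 5)%N.

(** Doubling makes every element even and, 2 being a non-residue, flips the sign of the h-th power;
    hence the exponent [i.+1]. *)
Lemma mem_Eset u i : (i < 2)%N ->
  (u%:R \in Eset p g i) =
  [&& ~~ odd u, u%:R != 0 :> 'F_p & (u%:R : 'F_p) ^+ h == (-1) ^+ i.+1].
Proof.
move=> i2; have two_h := two_expf_half p_mod8; have two0 := Fp_two_neq0.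
have p0 : p%:R = 0 :> 'F_p by rewrite pchar_Fp_0.
apply/imsetP/and3P => [[y]|[u_even u0 /eqP uh]].
  rewrite -[y]natr_Zp; set w := (y : nat); rewrite mem_Dset // => /and3P[_ w0 /eqP wh].
  move/eqP; rewrite -natrM Z2p_nat_eq => /andP[/eqP -> /eqP ->].
  rewrite natrM oddM mulf_neq0 // exprMn two_h wh mulN1r exprS mulN1r.
  by split.
(* Of the two solutions u/2 and u/2 + p of 2w = u modulo 2p, exactly one is odd. *)
pose w := (if odd u./2 then u./2 else u./2 + p)%N.
have w_odd : odd w by rewrite /w; case: ifP => // uh2; rewrite oddD p_odd uh2.
have wE : w%:R = (u./2)%:R :> 'F_p.
  by rewrite /w; case: ifP => // _; rewrite natrD p0 addr0.
have uE : u%:R = 2%:R * w%:R :> 'F_p by rewrite wE -natrM; congr _%:R; lia.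
exists w%:R; last first.
  by apply/eqP; rewrite -natrM Z2p_nat_eq natrM uE eqxx oddM andbT; case: odd u_even.
rewrite mem_Dset // w_odd /=.
have -> /= : w%:R != 0 :> 'F_p by apply: contraNneq u0 => w0; rewrite uE w0 mulr0.
apply/eqP; apply: oppr_inj.
by move: uh; rewrite uE exprMn two_h mulN1r exprS mulN1r.
Qed.

(* b is the parity of u and x its residue modulo p; since 2 is a non-residue, E_0
   consists of non-residues and E_1 of residues. *)
Definition parity_residue_value (b : bool) (x : 'F_p) : 'Z_4 :=
  if x == 0 then (if b then 2%:R else 0)
  else if b then (if x ^+ h == 1 then 0 else 1)
  else (if x ^+ h == 1 then 3%:R else 2%:R).

(** In this form, sums over a period split along Z/2p = Z/2 x Z/p. *)
Lemma quaternary_seqE u :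
  quaternary_seq p g u = parity_residue_value (odd u) u%:R.
Proof.
have p0 : p%:R = 0 :> 'F_p by rewrite pchar_Fp_0.
rewrite /quaternary_seq /parity_residue_value !mem_Dset // !mem_Eset //.
rewrite -[X in _ == X :> 'Z_(2 * p)]/(0%:R) !Z2p_nat_eq p_odd p0 /=.
rewrite expr0 expr1 !exprS expr0 !mulr1 mulrNN mulr1.
have [x0|x0] := eqVneq (u%:R : 'F_p) 0; first by case: (odd u).
have /orP[] := expf_half_pm1 x0 => /eqP ->.
  by case: (odd u); rewrite /= ?eqxx ?Fp_one_neqN1.
by case: (odd u); rewrite /= ?eqxx 1?eq_sym ?Fp_one_neqN1.
Qed.

End PrimeField.

(** * Generating polynomials and linear recurrences *)

Section PolynomialCongruence.

Import GRing.Theory.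
Local Open Scope ring_scope.

Variable R : comNzRingType.
Implicit Types (a b d : {poly R}) (s c : nat -> R).

(** An explicit cofactor makes sense over rings with zero divisors such as Z_4 and is carried along
    by reduction modulo 2. *)
Definition poly_cong d a b := exists q, a = b + q * d.

Lemma poly_cong_sum d n (a b : nat -> {poly R}) :
  (forall i, (i < n)%N -> poly_cong d (a i) (b i)) ->
  poly_cong d (\sum_(i < n) a i) (\sum_(i < n) b i).
Proof.
elim: n => [|n IHn] ab; first by exists 0; rewrite !big_ord0 mul0r addr0.
have [q qE] := IHn (fun i lt_in => ab i (ltnW lt_in)).
have [r rE] := ab n (leqnn _).
by exists (q + r); rewrite !big_ord_recr /= qE rE; ring.
Qed.

Lemma poly_congMl d a b e : poly_cong d a b -> poly_cong d (e * a) (e * b).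
Proof. by case=> q ->; exists (e * q); ring. Qed.

Lemma poly_cong_trans d a b e :
  poly_cong d a b -> poly_cong d b e -> poly_cong d a e.
Proof. by case=> q -> [r ->]; exists (r + q); ring. Qed.

Lemma poly_cong_Xn n m : poly_cong ('X^n - 1) 'X^m 'X^(m %% n).
Proof.
exists ('X^(m %% n) * \sum_(i < m %/ n) 'X^n ^+ i).
rewrite -mulrA [_ * ('X^n - 1)]mulrC -subrX1 -exprM {1}(divn_eq m n) exprD [in LHS]mulnC.
by ring.
Qed.

Definition period_poly (N : nat) s : {poly R} := \sum_(u < N) s u *: 'X^u.

Lemma period_poly_fold n N s :
  poly_cong ('X^n - 1) (period_poly N s) (\sum_(u < N) s u *: 'X^(u %% n)).
Proof.
pose a u := s u *: 'X^u : {poly R}; pose b u := s u *: 'X^(u %% n) : {poly R}.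
apply: (@poly_cong_sum _ N a b) => u _.
by rewrite /a /b -!mul_polyC; apply/poly_congMl/poly_cong_Xn.
Qed.

(** Multiplication by X modulo X^N - 1 rotates the coefficients; the offset m varies in the
    induction on i. *)
Lemma period_poly_shift N s (s_per : forall u, s (u + N)%N = s u) m i :
  poly_cong ('X^N - 1) ('X^i * period_poly N (fun v => s (v + (m + i))%N))
    (period_poly N (fun v => s (v + m)%N)).
Proof.
elim: i m => [|i IHi] m; first by exists 0; rewrite expr0 mul1r mul0r addr0 addn0.
have {IHi} := IHi m.+1.
have -> : period_poly N (fun v => s (v + (m.+1 + i))%N) =
          period_poly N (fun v => s (v + (m + i.+1))%N).
  by apply: eq_bigr => v _; rewrite addSnnS.
move=> cong; rewrite exprS -mulrA.
apply: poly_cong_trans (poly_congMl 'X cong) _.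
have shiftE : 'X * period_poly N (fun v => s (v + m.+1)%N) =
    \sum_(v < N) s (v.+1 + m)%N *: 'X^(v.+1).
  rewrite /period_poly big_distrr; apply: eq_bigr => v _ /=.
  by rewrite -addSnnS exprS -scalerAr.
(* The product has the term s_m X^N where the target has s_m X^0, whence the cofactor s_m. *)
exists (s m)%:P.
apply: (@addrI _ (s m *: 'X^0)); rewrite shiftE.
rewrite -(big_ord_recl N (fun v => s (v + m)%N *: 'X^v)) big_ord_recr /=.
by rewrite addnC s_per -!mul_polyC /period_poly expr0; ring.
Qed.

(** Modulo X^N - 1, multiplying by X^i delays the sequence by i, so each coefficient of the product
    is a recurrence sum, hence zero. *)
Lemma recurrence_period_poly N s c L (N_gt0 : (0 < N)%N)
    (s_per : forall u, s (u + N)%N = s u)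
    (s_rec : forall u, \sum_(i < L.+1) c i * s (u + L - i)%N = 0) :
  poly_cong ('X^N - 1) (period_poly L.+1 c * period_poly N s) 0.
Proof.
have s_perM k u : s (u + k * N)%N = s u.
  by elim: k => [|k IHk]; rewrite ?addn0 // mulSn addnCA addnC s_per.
pose a i := (c i *: 'X^i) * period_poly N s.
(* A delay by i is written as an advance by L N - i, where L N is a multiple of the period and at
   least i. *)
pose b i := c i *: period_poly N (fun v => s (v + (L * N - i))%N).
have -> : period_poly L.+1 c * period_poly N s = \sum_(i < L.+1) a i.
  by rewrite /period_poly big_distrl.
have sumb0 : \sum_(i < L.+1) b i = 0.
  rewrite /b /period_poly; under eq_bigr do rewrite scaler_sumr.
  rewrite exchange_big big1 // => v _ /=.
  under eq_bigr do rewrite scalerA.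
  rewrite -scaler_suml.
  rewrite (_ : \sum_i _ = \sum_(i < L.+1) c i * s ((v + (L * N - L)) + L - i)%N).
    by rewrite s_rec scale0r.
  by apply: eq_bigr => i _; congr (_ * s _); have := ltn_ord i; nia.
rewrite -[X in poly_cong _ _ X]sumb0.
apply: poly_cong_sum => i lt_iL; rewrite /a /b -!mul_polyC -mulrA.
apply: poly_congMl.
have le_iLN : (i <= L * N)%N by nia.
have := period_poly_shift s_per (L * N - i) i; rewrite subnK //.
rewrite (_ : period_poly N (fun v => s (v + L * N)%N) = period_poly N s) //.
by apply: eq_bigr => v _; rewrite s_perM.
Qed.

End PolynomialCongruence.

(** * Reduction of polynomials from Z_4 to F_2 *)

Section ReductionModTwo.

Import GRing.Theory.
Local Open Scope ring_scope.

Lemma Z4_natr m n : m = n %[mod 4] -> m%:R = n%:R :> 'Z_4.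
Proof. by move=> mn; rewrite -(@Zp_nat_mod 4 isT m) mn Zp_nat_mod. Qed.

Definition Z4_to_F2 (x : 'Z_4) : 'F_2 := (x : nat)%:R.

Fact Z4_to_F2_is_zmod_morphism : zmod_morphism Z4_to_F2.
Proof. by do 2![case=> [[|[|[|[|//]]]] ?]]; apply/eqP. Qed.

Fact Z4_to_F2_is_monoid_morphism : monoid_morphism Z4_to_F2.
Proof.
by split; [apply/eqP | do 2![case=> [[|[|[|[|//]]]] ?]]; apply/eqP].
Qed.

HB.instance Definition _ :=
  GRing.isZmodMorphism.Build _ _ Z4_to_F2 Z4_to_F2_is_zmod_morphism.
HB.instance Definition _ :=
  GRing.isMonoidMorphism.Build _ _ Z4_to_F2 Z4_to_F2_is_monoid_morphism.

Lemma Z4_to_F2_eq0 (x : 'Z_4) : (Z4_to_F2 x == 0) = (2%:R * x == 0).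
Proof. by case: x => [[|[|[|[|//]]]] ?]. Qed.

Lemma Z4_double_half (x : 'Z_4) : Z4_to_F2 x = 0 -> x = 2%:R * (x : nat)./2%:R.
Proof. by case: x => [[|[|[|[|//]]]] ?] // _; apply/eqP. Qed.

Local Notation red := (map_poly Z4_to_F2).

Lemma red_poly_eq0 (P : {poly 'Z_4}) : (red P == 0) = (2%:R *: P == 0).
Proof.
apply/eqP/eqP=> /polyP P0; apply/polyP=> i; move: (P0 i).
  by rewrite coef_map coefZ !coef0 => /eqP; rewrite Z4_to_F2_eq0 => /eqP.
by rewrite coef_map coefZ !coef0 => /eqP; rewrite -Z4_to_F2_eq0 => /eqP.
Qed.

Lemma red_poly_eq0_double (P : {poly 'Z_4}) :
  red P = 0 -> exists P', P = 2%:R *: P'.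
Proof.
move=> /polyP P0; exists (\poly_(i < size P) ((P`_i)%R : nat)./2%:R); apply/polyP=> i.
rewrite coefZ coef_poly; case: ltnP => [_|/(nth_default 0) ->]; last by rewrite mulr0.
by apply: Z4_double_half; have := P0 i; rewrite coef_map coef0.
Qed.

(** Modulo 2, W D = 0 in a domain, so W = 2 W'. Then 2 (P - W' D) = 0, that is, P = W' D modulo
    2. *)
Lemma dvd_red_of_double (D P W : {poly 'Z_4}) :
  red D != 0 -> 2%:R *: P = W * D -> red D %| red P.
Proof.
move=> D0 PE; have W0 : red W = 0.
  apply: (mulIf D0); rewrite mul0r -rmorphM -PE; apply/eqP.
  by rewrite red_poly_eq0 scalerA (_ : 2%:R * 2%:R = 0) ?scale0r //; apply/eqP.
have [W' W'E] := red_poly_eq0_double W0.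
apply/dvdpP; exists (red W'); apply/eqP; rewrite -subr_eq0 -rmorphM -rmorphB.
by rewrite red_poly_eq0 scalerBr PE W'E scalerAl subrr.
Qed.

End ReductionModTwo.

(** * Factors of X^(2p) - 1 over F_2 *)

Section Cyclotomic.

Import GRing.Theory.
Local Open Scope ring_scope.

Variable p : nat.
Hypothesis p_odd : odd p.

Local Notation Phi := (\sum_(i < p) 'X^i : {poly 'F_2}).

Lemma F2_poly_addxx (x : {poly 'F_2}) : x + x = 0.
Proof. by rewrite -mulr2n -mulr_natr -polyC_natr (pchar_Zp (isT : 1 < 2)%N) mulr0. Qed.

Lemma F2_sqr_sub1 (x : {poly 'F_2}) : (x - 1) ^+ 2 = x ^+ 2 - 1.
Proof.
rewrite sqrrB1 mulr2n F2_poly_addxx subr0; congr (_ + _).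
by apply/eqP; rewrite -addr_eq0 F2_poly_addxx.
Qed.

Lemma size_all_ones_poly : size Phi = p.
Proof.
rewrite (_ : Phi = \poly_(i < p) 1); first by rewrite size_poly_eq ?oner_eq0.
by rewrite poly_def; apply: eq_bigr => i _; rewrite scale1r.
Qed.

Lemma F2_Xn_sub1_sqr : 'X^(2 * p) - 1 = ('X - 1) ^+ 2 * Phi ^+ 2 :> {poly 'F_2}.
Proof. by rewrite -exprMn -subrX1 mulnC exprM F2_sqr_sub1. Qed.

(** S is a unit modulo Phi, hence coprime to Phi^2, and Gauss's lemma removes it from the
    product. *)
Lemma dvdp_all_ones_sqr (S C : {poly 'F_2}) :
  poly_cong Phi S (-1) -> poly_cong ('X^(2 * p) - 1) (C * S) 0 -> Phi ^+ 2 %| C.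
Proof.
case=> q SE [Q]; rewrite add0r F2_Xn_sub1_sqr => CSE.
have coSPhi : coprimep (Phi ^+ 2) S.
  rewrite coprimep_pexpl //; apply/Bezout_eq1_coprimepP; exists (q, -1).
  by rewrite SE /=; ring.
by rewrite -(Gauss_dvdpl C coSPhi) CSE mulrA dvdp_mull.
Qed.

(** Phi(1) = p = 1 in F_2, so Phi is coprime to X - 1 and the degrees of the two divisors add up. *)
Lemma size_all_ones_sqr_multiple (C : {poly 'F_2}) k :
  C != 0 -> ('X - 1) ^+ k %| C -> Phi ^+ 2 %| C -> (k + 2 * p.-1 < size C)%N.
Proof.
move=> C0 X1_C Phi_C.
have coPhi : coprimep (('X - 1) ^+ k) (Phi ^+ 2).
  have [->|k_gt0] := posnP k; first by rewrite expr0 coprime1p.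
  rewrite coprimep_pexpl // coprimep_pexpr // coprimep_sym.
  rewrite -[X in 'X - X]/(1%:P) coprimep_XsubC rootE horner_sum.
  under eq_bigr do rewrite hornerXn expr1n.
  rewrite sumr_const card_ord -(Fp_nat_mod (isT : prime 2)) modn2 p_odd.
  exact: oner_neq0.
have dvdC : ('X - 1) ^+ k * Phi ^+ 2 %| C by rewrite Gauss_dvdp // X1_C.
have := dvdp_leq C0 dvdC; apply: leq_trans.
have p_gt0 : (0 < p)%N by case: p p_odd.
have Phi0 : Phi != 0 by rewrite -size_poly_eq0 size_all_ones_poly -lt0n.
rewrite -[X in 'X - X]/(1%:P) mulrC size_Mmonic ?expf_neq0 //; last first.
  by rewrite monic_exp // monicXsubC.
rewrite size_exp_XsubC addnS /=.
have := size_exp Phi 2; rewrite size_all_ones_poly.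
have : (0 < size (Phi ^+ 2)%R)%N by rewrite size_poly_gt0 expf_neq0.
by move: (size _) => n; lia.
Qed.

End Cyclotomic.

(** * The generating polynomial of the sequence *)

Section QuaternarySequence.

Import GRing.Theory.
Local Open Scope ring_scope.

Variables (p : nat) (g : int).
Hypotheses (p_prime : prime p) (p_odd : odd p).
Hypotheses (g_root : primitive_root_mod p g) (g_odd : odd `|g|%N).
Hypothesis p_mod8 : (p %% 8 = 3 \/ p %% 8 = 5)%N.
Let h := p.-1./2.
Local Notation s := (quaternary_seq p g).
Local Notation value := (@parity_residue_value p).
Local Notation S := (period_poly (2 * p) s).

Lemma quaternary_seq_period u : s (u + 2 * p)%N = s u.
Proof.
by rewrite /quaternary_seq natrD pchar_Zp ?addr0 //; have := prime_gt1 p_prime; lia.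
Qed.

Lemma sum_Fp (V : nmodType) (G : 'F_p -> V) : \sum_x G x = \sum_(k < p) G k%:R.
Proof.
under eq_bigr do rewrite -[X in G X]natr_Zp.
by rewrite -(big_mkord xpredT (fun k => G k%:R)) Fp_cast // big_mkord.
Qed.

(** Pair k with k + p: same residue modulo p, opposite parities because p is odd. *)
Lemma sum_parity_Fp (V : nmodType) (F : bool -> 'F_p -> V) :
  \sum_(u < 2 * p) F (odd u) u%:R = \sum_x (F true x + F false x).
Proof.
rewrite mul2n -addnn big_split_ord /= sum_Fp -big_split; apply: eq_bigr => k _ /=.
rewrite natrD pchar_Fp_0 // add0r oddD p_odd /=.
by case: (odd k) => //=; rewrite addrC.
Qed.

(** Multiplication by g exchanges residues and non-residues, so there are h of each. *)
Lemma sum_half_residues (V : nmodType) (a b : V) :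
  \sum_(x : 'F_p | x != 0) (if x ^+ h == 1 then a else b) = (a + b) *+ h.
Proof.
have g0 := root_neq0 p_prime g_root.
pose A := [pred x : 'F_p | (x != 0) && (x ^+ h == 1)].
pose B := [pred x : 'F_p | (x != 0) && (x ^+ h != 1)].
have AB : #|B| = #|A|.
  rewrite -!sum1_card (reindex_inj (mulfI g0)); apply: eq_bigl => x.
  rewrite !inE mulf_eq0 (negbTE g0) exprMn (root_half p_prime p_odd g_root) mulN1r /=.
  have [//|x0] := eqVneq x 0.
  have N1 := Fp_one_neqN1 p_prime p_odd.
  have /orP[/eqP ->|/eqP ->] := expf_half_pm1 p_prime p_odd x0.
    by rewrite eq_sym N1 eqxx.
  by rewrite opprK eqxx eq_sym N1.
have cardAB : (#|A| + #|B| = p.-1)%N.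
  rewrite -[in RHS](card_Fp p_prime) -(cardC1 (0 : 'F_p)) -!sum1_card.
  by rewrite [in RHS](bigID (fun x => x ^+ h == 1)).
have cardA : #|A| = h by rewrite /h -cardAB AB addnn doubleK.
rewrite big_if mulrnDl; congr (_ + _).
  by rewrite -[in RHS]cardA -sumr_const; apply: eq_bigl => x; rewrite !inE.
by rewrite -[in RHS]cardA -AB -sumr_const; apply: eq_bigl => x; rewrite !inE.
Qed.

(** Phi divides X^p - 1, so exponents may be folded modulo p; the folded polynomial is 3 Phi - 1. *)
Lemma S_mod_all_ones : poly_cong (\sum_(i < p) 'X^i) S (-1).
Proof.
have [q qE] := period_poly_fold p (2 * p) s.
pose F b (x : 'F_p) := value b x *: 'X^x : {poly 'Z_4}.
have SE : \sum_(u < 2 * p) s u *: 'X^(u %% p) = \sum_(i < p) 3%:R *: 'X^i - 1.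
  rewrite (eq_bigr (fun u : 'I_(2 * p) => F (odd u) u%:R)) => [|u _]; last first.
    by rewrite /F -(quaternary_seqE p_prime p_odd g_root g_odd p_mod8) val_Fp_nat.
  have valueE x : F true x + F false x = (3%:R - (x == 0)%:R) *: 'X^x.
    rewrite -scalerDl /value; congr (_ *: _).
    (* The two values add up to 2 + 0 at x = 0, and to 0 + 3 or 1 + 2 elsewhere. *)
    by case: ifP => _; [|case: ifP => _]; apply/eqP.
  rewrite sum_parity_Fp; under eq_bigr do rewrite valueE scalerBl.
  rewrite sumrB [X in _ - X](bigD1 (0 : 'F_p)) //=; congr (_ - _).
    rewrite sum_Fp; apply: eq_bigr => k _.
    by rewrite val_Fp_nat // modn_small.
  by rewrite expr0 scale1r big1 ?addr0 // => x /negbTE ->; rewrite scale0r.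
exists (3%:R + q * ('X - 1)); rewrite qE SE subrX1 -scaler_sumr scaler_nat -mulr_natl.
by ring.
Qed.

(** Even indices contribute 0 once and 3 and 2 each h times; odd indices contribute 2 once and 0 and
    1 each h times. *)
Lemma S_mod_X2_sub1 :
  poly_cong ('X^2 - 1) S ((5 * h)%:R%:P + (2 + h)%:R *: 'X).
Proof.
have [q qE] := period_poly_fold 2 (2 * p) s.
pose F (b : bool) (x : 'F_p) := value b x *: 'X^b : {poly 'Z_4}.
have SE : \sum_(u < 2 * p) s u *: 'X^(u %% 2) = (5 * h)%:R%:P + (2 + h)%:R *: 'X.
  rewrite (eq_bigr (fun u : 'I_(2 * p) => F (odd u) u%:R)) => [|u _]; last first.
    by rewrite /F -(quaternary_seqE p_prime p_odd g_root g_odd p_mod8) modn2.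
  have value_sum b : \sum_x value b x = if b then (2 + h)%:R else (5 * h)%:R.
    rewrite (bigD1 0) //= (eq_bigr (fun x => if x ^+ h == 1
      then if b then 0 else 3%:R else if b then 1 else 2%:R)) => [|x /negbTE x0].
      rewrite sum_half_residues /value eqxx; case: b.
        by rewrite add0r natrD.
      by rewrite add0r -natrD natrM mulr_natr.
    by rewrite /value x0; case: b.
  rewrite sum_parity_Fp big_split /= -!scaler_suml !value_sum addrC.
  by rewrite expr0 expr1 alg_polyC.
by exists q; rewrite -SE.
Qed.

(** * Lower bounds on the length of a recurrence *)

Local Notation red := (map_poly Z4_to_F2).

(** Take C = 1 + c_1 X + ... + c_M X^M; the constant term 1 survives reduction. *)
Lemma recurrence_red_poly M : has_recurrence s M ->
  exists C : {poly 'Z_4}, [/\ red C != 0, (size (red C) <= M.+1)%N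
    & poly_cong ('X^(2 * p) - 1) (C * S) 0].
Proof.
case=> c rec; pose d i := if i == 0%N then 1 else c i.
exists (period_poly M.+1 d).
have CE : period_poly M.+1 d = \poly_(i < M.+1) d i by rewrite poly_def.
split.
- apply/eqP=> /polyP/(_ 0%N); rewrite coef_map CE coef_poly coef0 /=.
  by rewrite /d /= rmorph1 => /eqP; rewrite oner_eq0.
- by rewrite CE (leq_trans (size_poly _ _)) // size_poly.
apply: recurrence_period_poly => [|u|u]; first by have := prime_gt0 p_prime; lia.
  exact: quaternary_seq_period.
by rewrite big_ord_recl /d /= subn0 mul1r -[RHS](rec u) big_add1 big_mkord.
Qed.

(** The part common to both cases: Phi^2 always divides C modulo 2, and only the power of X - 1
    depends on p modulo 8. *)
Lemma quaternary_recurrence_lower k M :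
  (forall C, poly_cong ('X^(2 * p) - 1) (C * S) 0 -> ('X - 1) ^+ k %| red C) ->
  has_recurrence s M -> (k + 2 * p.-1 <= M)%N.
Proof.
move=> dvdk /recurrence_red_poly[C [C0 size_C CS]].
rewrite -ltnS; apply: leq_trans size_C.
apply: size_all_ones_sqr_multiple => //; first exact: dvdk.
apply: (@dvdp_all_ones_sqr p (red S)).
  have [q qE] := S_mod_all_ones; exists (red q).
  rewrite qE rmorphD rmorphN1 rmorphM rmorph_sum.
  by congr (_ + _ * _); apply: eq_bigr => i _; rewrite /= map_polyXn.
have [q qE] := CS; exists (red q).
by rewrite -rmorphM qE !add0r rmorphM rmorphB rmorph1 /= map_polyXn.
Qed.

Lemma X2_sub1_dvd_X2p_sub1 (R : comNzRingType) :
  exists q : {poly R}, 'X^(2 * p) - 1 = q * ('X^2 - 1).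
Proof. by exists (\sum_(i < p) 'X^2 ^+ i); rewrite exprM subrX1 mulrC. Qed.

Lemma red_X2_sub1 : red ('X^2 - 1) = ('X - 1) ^+ 2.
Proof. by rewrite rmorphB rmorph1 /= map_polyXn F2_sqr_sub1. Qed.

Lemma X_sub1_exp_dvd_annihilator_5mod8 (C : {poly 'Z_4}) : (p %% 8 = 5)%N ->
  poly_cong ('X^(2 * p) - 1) (C * S) 0 -> ('X - 1) ^+ 2 %| red C.
Proof.
move=> p5 [Q]; have [q ->] := S_mod_X2_sub1.
have [w ->] := X2_sub1_dvd_X2p_sub1 'Z_4.
(* Here h = 2 modulo 4. *)
have -> : (5 * h)%:R = 2%:R :> 'Z_4 by apply: Z4_natr; rewrite /h; lia.
have -> : (2 + h)%:R = 0%:R :> 'Z_4 by apply: Z4_natr; rewrite /h; lia.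
rewrite scale0r addr0 add0r mulrDr => CE.
rewrite -red_X2_sub1; apply: (@dvd_red_of_double _ _ (Q * w - C * q)).
  by rewrite red_X2_sub1 expf_neq0 // -[X in 'X - X]/(1%:P) polyXsubC_eq0.
by rewrite -mul_polyC mulrC mulrBl -[Q * w * _]mulrA -CE; ring.
Qed.

Lemma X_sub1_exp_dvd_annihilator_3mod8 (C : {poly 'Z_4}) : (p %% 8 = 3)%N ->
  poly_cong ('X^(2 * p) - 1) (C * S) 0 -> ('X - 1) ^+ 1 %| red C.
Proof.
move=> p3 [Q]; have [q ->] := S_mod_X2_sub1.
have [w ->] := X2_sub1_dvd_X2p_sub1 'Z_4.
(* Here h = 1 modulo 4. *)
have -> : (5 * h)%:R = 1 :> 'Z_4 by apply: (@Z4_natr _ 1); rewrite /h; lia.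
have -> : (2 + h)%:R = -1 :> 'Z_4.
  by rewrite (_ : -1 = 3%:R); [apply: Z4_natr; rewrite /h; lia | apply/eqP].
rewrite scaleN1r polyC1 add0r => /(congr1 red).
rewrite !rmorphM rmorphD rmorphB rmorphM rmorph1 /= !red_X2_sub1 map_polyX mulrA.
set Cb := red C; set W := red Q * red w; set qb := red q => CE.
have X1_neq0 : 'X - 1 != 0 :> {poly 'F_2}.
  by rewrite -[X in 'X - X]/(1%:P) polyXsubC_eq0.
(* Every term of [CE] is a multiple of X - 1; one factor cancels in the domain F_2[X]. *)
have {}CE : Cb = (Cb * qb - W) * ('X - 1).
  apply: (mulIf X1_neq0); apply: (@subr0_eq _ _ _); apply: oppr_inj.
  by rewrite oppr0 -(subrr (W * ('X - 1) ^+ 2)) -{1}CE; ring.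
by rewrite expr1 CE dvdp_mull.
Qed.

(** * Recurrences attaining the bounds *)

Lemma quaternary_recurrence_2p : has_recurrence s (2 * p).
Proof.
have p_gt0 := prime_gt0 p_prime.
exists (fun i => if i == (2 * p)%N then -1 else 0) => u.
rewrite big_nat_recr /=; last by lia.
rewrite eqxx addnK big_nat big1 => [|i /andP[_ lt_i]]; last first.
  by rewrite ltn_eqF // mul0r.
by rewrite add0r quaternary_seq_period mulN1r subrr.
Qed.

Lemma sum_period_shift u :
  \sum_(i < 2 * p) s (u + i)%N = \sum_(i < 2 * p) s i.
Proof.
elim: u => [|u <-] //.
have : \sum_(i < (2 * p).+1) s (u + i)%N =
    \sum_(i < 2 * p) s (u + i)%N + s (u + 2 * p)%N by rewrite big_ord_recr.
rewrite big_ord_recl addn0 quaternary_seq_period addrC => /addIr <-.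
by apply: eq_bigr => i _; rewrite addSnnS.
Qed.

Lemma quaternary_recurrence_2p_sub1 :
  (p %% 8 = 3)%N -> has_recurrence s (2 * p - 1).
Proof.
move=> p3; have p_gt0 := prime_gt0 p_prime; exists (fun=> 1) => u.
have sum0 : \sum_(i < 2 * p) s i = 0.
  (* At X = 1 the modulus X^2 - 1 vanishes, so S(1) = 6h + 2, which is 0 modulo 4 as h = 1 modulo
     4. *)
  have [q] := S_mod_X2_sub1; move/(congr1 (horner^~ 1)).
  rewrite !(hornerD, hornerN, hornerXn, hornerM, hornerC, hornerZ, hornerX).
  rewrite expr1n subrr mulr0 addr0 mulr1 -natrD horner_sum => SE.
  rewrite -[RHS](Z4_natr (_ : 5 * h + (2 + h) = 0 %[mod 4])) => [|]; last by rewrite /h; lia.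
  by rewrite -SE; apply: eq_bigr => i _; rewrite hornerZ hornerXn expr1n mulr1.
rewrite -[RHS]sum0 -(sum_period_shift u) big_add1 big_mkord.
have [m pE] : exists m, (2 * p = m.+1)%N by exists (2 * p).-1; lia.
(* The recurrence lists the 2p consecutive terms backwards from its leading one. *)
rewrite pE subn1 /= big_ord_recr addrC (reindex_inj rev_ord_inj) /=.
by congr (_ + _); apply: eq_bigr => i _; rewrite mul1r; congr (s _); have := ltn_ord i; lia.
Qed.

End QuaternarySequence.

Theorem theorem9 (p : nat) (g : int)
  (p_prime : prime p) (p_odd : odd p) (g_odd : odd `|g|%N)
  (g_root_p : primitive_root_mod p g)
  (g_root_2p : primitive_root_mod (2 * p) g) :
  ((p%:Z = - 3%:Z %[mod 8])%Z ->
     linear_complexity (quaternary_seq p g) (2 * p)) /\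
  ((p%:Z = 3%:Z %[mod 8])%Z ->
     linear_complexity (quaternary_seq p g) (2 * p - 1)).
Proof.
have p_gt1 := prime_gt1 p_prime.
split=> p8.
  have p5 : p %% 8 = 5 by lia.
  have p35 : p %% 8 = 3 \/ p %% 8 = 5 by right.
  split; first exact: quaternary_recurrence_2p.
  move=> M /(quaternary_recurrence_lower p_prime p_odd g_root_p g_odd p35) leM.
  (* 2 + 2(p - 1) = 2p. *)
  apply: leq_trans (leM 2 _); first by lia.
  by move=> C; apply: X_sub1_exp_dvd_annihilator_5mod8.
have p3 : p %% 8 = 3 by lia.
have p35 : p %% 8 = 3 \/ p %% 8 = 5 by left.
split; first exact: quaternary_recurrence_2p_sub1.
move=> M /(quaternary_recurrence_lower p_prime p_odd g_root_p g_odd p35) leM.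
(* 1 + 2(p - 1) = 2p - 1. *)
apply: leq_trans (leM 1 _); first by lia.
by move=> C; apply: X_sub1_exp_dvd_annihilator_3mod8.
Qed.
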